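(* Every number field $K$ which is neither $\mathbb{Q}$ nor an imaginary quadratic field contains an even unit different from $\pm 1$. In particular, $\mathrm{ev}(K)<\infty$.
   Context: For an integer polynomial $g(x)=b_nx^n+\dots+b_0$, its length is $L(g)=|b_n|+\dots+|b_0|$. An algebraic integer $\alpha$ is called even if $L(f)$ is even, where $f$ is the minimal monic polynomial of $\alpha$ over $\mathbb{Q}$, and odd otherwise. Units are units of the ring of integers of $K$. A sum $\varepsilon_1+\dots+\varepsilon_k$ has a proper vanishing subsum if there is a nonempty proper subset $I\subsetneq\{1,\dots,k\}$ with $\sum_{i\in I}\varepsilon_i=0$. $\mathrm{ev}(K)$ is the smallest even $k\geq 4$ such that there exist units $\varepsilon_1,\dots,\varepsilon_k$ of $K$ with $\varepsilon_1+\dots+\varepsilon_k=0$ and no proper vanishing subsum ($\infty$ if none exists). *)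

(* Defs.v *)
From HB Require Import structures.
From mathcomp Require Export all_boot all_order all_algebra all_field.
From mathcomp Require Import boolp.

Set Implicit Arguments.
Unset Strict Implicit.
Unset Printing Implicit Defensive.

Import GRing.Theory Num.Theory.

Local Open Scope ring_scope.

(* A number field is a [K : fieldExtType rat]. Its subfield Q is [1%VS], and
   [{:K}%VS] is K itself. *)

Definition imaginary_quadratic (K : fieldExtType rat) : Prop :=
  exists (d : int) (x : K),
    [/\ d < 0, x ^+ 2 = d%:~R & <<1; x>>%VS = {:K}%VS].

Definition alg_integer (K : fieldExtType rat) (x : K) : Prop :=
  integralOver (intr : int -> K) x.

Definition int_unit (K : fieldExtType rat) (u : K) : Prop :=
  alg_integer u /\ exists2 v : K, alg_integer v & u * v = 1.

Definition poly_length (g : {poly int}) : nat :=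
  (\sum_(i < size g) absz (g`_i)%R)%N.

(* [f] is the minimal polynomial over Q. It is unique since [intr] is
   injective, and it exists for every algebraic integer by Gauss's lemma. *)
Definition even_integer (K : fieldExtType rat) (x : K) : Prop :=
  alg_integer x /\
  exists2 f : {poly int},
    map_poly (intr : int -> K) f = minPoly 1%VS x & ~~ odd (poly_length f).

Definition has_proper_vanishing_subsum (K : fieldExtType rat) (k : nat)
    (eps : 'I_k -> K) : Prop :=
  exists I : {set 'I_k},
    [/\ I != set0, I \proper [set: 'I_k] & \sum_(i in I) eps i = 0].

Definition ev_admissible (K : fieldExtType rat) (k : nat) : Prop :=
  [/\ ~~ odd k, (4 <= k)%N &
      exists eps : 'I_k -> K,
        [/\ forall i, int_unit (eps i),
            \sum_(i < k) eps i = 0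
          & ~ has_proper_vanishing_subsum eps]].

(* [None] stands for infinity. *)
Definition ev (K : fieldExtType rat) : option nat :=
  if pselect (exists k, `[< ev_admissible K k >]) is left exk
  then Some (ex_minn exk) else None.

(* Main.v *)
(** A unit [u <> 1, -1] that is congruent to 1 modulo 2 is even: if
    [u = 1 + 2 d] has minimal polynomial [g], then [g(1) = - 2 d q(u)] for some
    integer polynomial [q], so that [g(1) / 2] is a rational algebraic integer,
    and [L(g)] has the parity of [g(1)].

    Such a [u] of infinite order comes from Dirichlet's argument. Write
    [K = Q(x)] with [x] integral of degree [n >= 2]. Let [z0] be a real
    conjugate of [x] or, if there is none, a nonreal one; then [n >= 3], because
    [K] is not imaginary quadratic. By the pigeonhole principle, there are
    infinitely many [p(x)] in [Z[x]] whose norms are bounded by some [B], while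
    the [|p(z0)|] decrease strictly. Two of them are congruent modulo [2 B!].
    Since [p(x)] divides its norm in [Z[x]], hence [B!], the quotient of these
    two is a unit of [Z[x]] congruent to 1 modulo 2. It has absolute value less
    than 1 at [z0], hence infinite order.

    Finally, the relation [g(u) = 0], in which the term [c u^i] is read as [|c|]
    summands [sgn(c) u^i], is a vanishing sum of [L(g)] units. A vanishing
    subsum is the value at [u] of a polynomial of degree at most [deg g], hence
    of [0] or of [g] since [g] is monic: it is empty or full. As [L(g)] is even
    and [u] has infinite order, so that [g] is not [X^n + 1] or [X^n - 1],
    [L(g) >= 4]. *)

Require Import Defs.
From mathcomp Require Import all_boot all_order all_algebra all_field.
From mathcomp Require Import boolp zify ring.

Set Implicit Arguments.
Unset Strict Implicit.
Unset Printing Implicit Defensive.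

Import Order.TTheory GRing.Theory Num.Theory.

Local Open Scope ring_scope.

Local Notation zeval x p := (map_poly intr p).[x].

(** * Integer polynomials and integral primitive elements *)

Lemma intr_fieldExt_inj (K : fieldExtType rat) : injective (intr : int -> K).
Proof.
move=> a b eq_ab; apply: (@intr_inj rat); apply: (fmorph_inj (in_alg K)).
by rewrite !rmorph_int.
Qed.

Lemma size_map_intr (K : fieldExtType rat) (p : {poly int}) :
  size (map_poly (intr : int -> K) p) = size p.
Proof. by apply: size_map_inj_poly => //; exact: intr_fieldExt_inj. Qed.

Lemma size_minPoly_leq (K : fieldExtType rat) (x : K) (p : {poly int}) :
  zeval x p = 0 -> p != 0 -> (size (minPoly 1 x) <= size p)%N.
Proof.
move=> px0 p0; rewrite -(size_map_intr K); apply: dvdp_leq.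
  by rewrite -size_poly_eq0 size_map_intr size_poly_eq0.
apply: minPoly_dvdp; last exact/eqP.
by apply/polyOverP => i; rewrite coef_map /= rpred_int.
Qed.

(** Gauss's lemma: the rational minimal polynomial [g] divides a monic integer polynomial [p], so a
    rational multiple [h] of [g] is integral and divides [p] in [Z[X]]. The leading coefficient of
    [h] divides 1, hence is a sign, and [g] is [h] up to that sign. *)
Lemma int_minPoly (K : fieldExtType rat) (x : K) :
  alg_integer x ->
  exists2 f : {poly int}, f \is monic & map_poly intr f = minPoly 1 x.
Proof.
case=> p mon_p root_p.
have /polyOver1P[g Dg] := minPolyOver 1 x.
have mon_g : g \is monic by rewrite -(map_monic (in_alg K)) -Dg monic_minPoly.
have mapK q : map_poly (in_alg K) (map_poly intr q) = map_poly intr q.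
  rewrite -map_poly_comp; apply: eq_map_poly => z.
  exact: (rmorph_int (in_alg K)).
have : g %| map_poly intr p.
  rewrite -(dvdp_map (in_alg K)) mapK -Dg minPoly_dvdp //.
  by apply/polyOverP => i; rewrite coef_map /= rpred_int.
case/dvdpP_rat_int=> h [a a0 Dgh] [r Dr].
have unit_h : lead_coef h \is a GRing.unit.
  apply/unitrP; exists (lead_coef r).
  by rewrite [_ * lead_coef h]mulrC -lead_coefM -Dr (eqP mon_p).
set c := lead_coef h in unit_h *.
have c2 : c * c = 1 by case/orP: unit_h => /eqP->.
have ac : a * c%:~R = 1.
  move: mon_g; rewrite Dgh monicE lead_coefZ lead_coef_map_inj //.
    by move/eqP.
  exact: intr_inj.
have {}ac : a = c%:~R.
  have : a * (c * c)%:~R = c%:~R by rewrite rmorphM mulrA ac mul1r.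
  by rewrite c2 mulr1.
exists (c *: h); first by rewrite monicE lead_coefZ c2.
by rewrite Dg Dgh ac -mapK; congr map_poly; rewrite map_polyZ.
Qed.

Lemma alg_integer_zeval (K : fieldExtType rat) (x : K) (p : {poly int}) :
  alg_integer x -> alg_integer (zeval x p).
Proof.
move=> int_x; apply: integral_horner => //.
by apply/integral_poly => i; rewrite coef_map; apply: integral_id.
Qed.

(** For [p] of degree [n + 1], the product [c ^ n * p(X)] is a monic integer polynomial in [c * X],
    namely [q] below. *)
Lemma lead_coefM_alg_integer (K : fieldExtType rat) (x : K) (p : {poly int}) :
  zeval x p = 0 -> p != 0 -> alg_integer ((lead_coef p)%:~R * x).
Proof.
move=> px0 p0; set c := lead_coef p.
have c0 : c%:~R != 0 :> K.
  by rewrite -(rmorph0 intr) (inj_eq (@intr_fieldExt_inj K)) lead_coef_eq0.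
have [n Dn] : exists n, size p = n.+2.
  case Dn: (size p) p0 => [|[|n]] p0; last by exists n.
    by move/eqP: Dn; rewrite size_poly_eq0 (negPf p0).
  move/eqP: px0; rewrite horner_coef size_map_intr Dn big_ord1 coef_map.
  by rewrite expr0 mulr1 /= => /idPn[]; move: c0; rewrite /c /lead_coef Dn.
have Dc : p`_n.+1 = c by rewrite /c /lead_coef Dn.
pose q : {poly int} :=
  \poly_(i < n.+2) (if i == n.+1 then 1 else p`_i * c ^+ (n - i)).
have qn : q`_n.+1 = 1 by rewrite coef_poly ltnSn eqxx.
have sq : size q = n.+2 by rewrite size_poly_eq // eqxx.
exists q; first by rewrite monicE /lead_coef sq qn.
rewrite rootE horner_coef size_map_intr sq.
have <- : c%:~R ^+ n * zeval x p =
    \sum_(i < n.+2) (map_poly intr q)`_i * (c%:~R * x) ^+ i.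
  rewrite horner_coef size_map_intr Dn mulr_sumr; apply: eq_bigr => i _.
  rewrite !coef_map /= coef_poly ltn_ord exprMn; case: eqP => [->|neq_i].
    by rewrite Dc mul1r mulrA -exprSr.
  have le_i : (i <= n)%N by move: (ltn_ord i) neq_i; lia.
  rewrite rmorphM rmorphXn /= -{1}(subnK le_i) exprD !mulrA; congr (_ * _).
  by rewrite mulrC mulrA.
by rewrite px0 mulr0.
Qed.

(** A primitive element [y] exists by separability in characteristic 0. A nonzero integer multiple
    of [y] is integral and generates the same field. *)
Lemma alg_integer_primitive (K : fieldExtType rat) :
  exists2 x : K, alg_integer x & <<1; x>>%VS = {:K}%VS.
Proof.
set y := separable_generator 1 (aspacef K).
have genK : (<<1; y>> = {:K})%VS.
  rewrite -(@eq_adjoin_separable_generator _ _ (aspacef K) 1%AS) ?sub1v //.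
  apply/separableP => z _; apply: pcharf0_separable => p.
  by rewrite GRing.pchar_lalg pchar_num.
have /polyOver1P[g Dg] := minPolyOver 1 y.
have [q [a a0 Dgq]] := rat_poly_scale g.
have q0 : q != 0.
  apply/eqP => q0; move: (monic_neq0 (monic_minPoly 1 y)).
  by rewrite Dg Dgq q0 rmorph0 scaler0 rmorph0 eqxx.
have qy : zeval y q = 0.
  have := minPolyxx 1 y; rewrite Dg Dgq map_polyZ hornerZ => /eqP.
  rewrite mulf_eq0 fmorph_eq0 invr_eq0 intr_eq0 (negPf a0) => /eqP <-.
  congr (_.[_]); rewrite -map_poly_comp; apply: eq_map_poly => z.
  exact: esym (rmorph_int (in_alg K) z).
exists ((lead_coef q)%:~R * y); first exact: lead_coefM_alg_integer.
apply/eqP; rewrite -genK eqEsubv; apply/andP; split; apply/FadjoinP.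
  by rewrite subv_adjoin rpredM ?rpred_int ?memv_adjoin.
rewrite subv_adjoin; split=> //.
have c0 : (lead_coef q)%:~R != 0 :> K.
  by rewrite -(rmorph0 intr) (inj_eq (@intr_fieldExt_inj K)) lead_coef_eq0.
rewrite -[X in X \in _](mulKf c0) rpredM ?rpredV ?rpred_int //.
exact: memv_adjoin.
Qed.

(** * Values of integer polynomials and transfer to conjugates *)

Lemma zevalC (R : comNzRingType) (z : R) (c : int) : zeval z c%:P = c%:~R.
Proof. by rewrite map_polyC hornerC. Qed.

Lemma zevalXn (R : comNzRingType) (z : R) n : zeval z 'X^n = z ^+ n.
Proof. by rewrite map_polyXn hornerXn. Qed.

Lemma zevalZ (R : comNzRingType) (z : R) (c : int) p :
  zeval z (c *: p) = c%:~R * zeval z p.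
Proof. by rewrite map_polyZ hornerZ. Qed.

Lemma zevalD (R : comNzRingType) (z : R) p q :
  zeval z (p + q) = zeval z p + zeval z q.
Proof. by rewrite rmorphD hornerD. Qed.

Lemma zevalB (R : comNzRingType) (z : R) p q :
  zeval z (p - q) = zeval z p - zeval z q.
Proof. by rewrite rmorphB hornerD hornerN. Qed.

Lemma zevalM (R : comNzRingType) (z : R) p q :
  zeval z (p * q) = zeval z p * zeval z q.
Proof. by rewrite rmorphM hornerM. Qed.

Lemma zevalX (R : comNzRingType) (z : R) p n :
  zeval z (p ^+ n) = zeval z p ^+ n.
Proof. by rewrite rmorphXn horner_exp. Qed.

Lemma zeval_sum (R : comNzRingType) (z : R) (I : Type) (r : seq I)
    (P : pred I) (F : I -> {poly int}) :
  zeval z (\sum_(i <- r | P i) F i) = \sum_(i <- r | P i) zeval z (F i).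
Proof. by rewrite rmorph_sum horner_sum. Qed.

(** The remainder of [p] modulo [f] vanishes at [x] and has smaller degree than the minimal
    polynomial, so it is 0 and [f] divides [p] in [Z[X]]. *)
Lemma zeval_eq0_transfer (K : fieldExtType rat) (x : K) (f p : {poly int})
    (R : comNzRingType) (z : R) :
  f \is monic -> map_poly intr f = minPoly 1 x ->
  zeval x p = 0 -> zeval z f = 0 -> zeval z p = 0.
Proof.
move=> mon_f Df px0 fz0.
have fx0 : zeval x f = 0 by rewrite Df minPolyxx.
have Dp := Pdiv.RingMonic.rdivp_eq mon_f p.
set r := Pdiv.Ring.rmodp p f in Dp.
have rx0 : zeval x r = 0.
  by move: px0; rewrite Dp zevalD zevalM fx0 mulr0 add0r.
have [r0|r_neq0] := eqVneq r 0.
  by rewrite Dp r0 addr0 zevalM fz0 mulr0.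
have := size_minPoly_leq rx0 r_neq0.
by rewrite -Df size_map_intr leqNgt Pdiv.Ring.ltn_rmodpN0 ?monic_neq0.
Qed.

Lemma zeval_primitive (K : fieldExtType rat) (x y : K) :
  <<1; x>>%VS = {:K}%VS ->
  exists w : {poly int}, exists2 a : int, a != 0 & a%:~R * y = zeval x w.
Proof.
move=> genK; have /Fadjoin_polyP[g g_rat ->] : y \in <<1; x>>%VS.
  by rewrite genK memvf.
have /polyOver1P[h ->] := g_rat.
have [w [a a0 ->]] := rat_poly_scale h.
exists w, a => //; rewrite map_polyZ hornerZ mulrA.
rewrite -[a%:~R in LHS](rmorph_int (in_alg K)) -rmorphM mulfV ?intr_eq0 //.
rewrite rmorph1 mul1r -map_poly_comp; congr (_.[_]); apply: eq_map_poly => z.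
exact: (rmorph_int (in_alg K)).
Qed.

Lemma zeval_neq0_transfer (K : fieldExtType rat) (x : K) (f p : {poly int})
    (z : algC) :
  f \is monic -> map_poly intr f = minPoly 1 x -> <<1; x>>%VS = {:K}%VS ->
  zeval x p != 0 -> zeval z f = 0 -> zeval z p != 0.
Proof.
move=> mon_f Df genK px0 fz0.
(* The inverse of [p(x)] is [w(x) / a], and [p w = a] carries over to [z]. *)
have [w [a a0 Dw]] := zeval_primitive (zeval x p)^-1 genK.
have pwx : zeval x (p * w - a%:P) = 0.
  rewrite zevalB zevalM zevalC -Dw.
  by rewrite mulrCA mulfV // mulr1 subrr.
have := zeval_eq0_transfer mon_f Df pwx fz0.
rewrite zevalB zevalM zevalC.
by apply: contra_eq_neq => ->; rewrite mul0r sub0r oppr_eq0 intr_eq0.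
Qed.

Lemma zeval_small_neq0 (K : fieldExtType rat) (x : K) (f p : {poly int}) :
  map_poly intr f = minPoly 1 x ->
  p != 0 -> (size p < size f)%N -> zeval x p != 0.
Proof.
move=> Df p0; apply: contraTneq => px0.
by rewrite -leqNgt -(size_map_intr K f) Df size_minPoly_leq.
Qed.

Lemma minPoly_complex_roots (K : fieldExtType rat) (x : K) (f : {poly int}) :
  f \is monic -> map_poly intr f = minPoly 1 x -> <<1; x>>%VS = {:K}%VS ->
  exists2 zs : seq algC,
    uniq zs & map_poly intr f = \prod_(z <- zs) ('X - z%:P).
Proof.
move=> mon_f Df genK.
have [zs Dzs] := closed_field_poly_normal (map_poly intr f : {poly algC}).
move: Dzs; rewrite (eqP (monic_map _ mon_f)) scale1r => Dzs.
exists zs => //; rewrite -separable_prod_XsubC -Dzs.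
(* The derivative is nonzero at [x] by separability, hence at every complex root of [f]: all of them
   are simple. *)
have der_x : zeval x f^`() != 0.
  rewrite -deriv_map Df.
  have := separable_root_der 1 x; rewrite pcharf0_separable => [|p].
    by [].
  by rewrite GRing.pchar_lalg pchar_num.
rewrite separable_poly.unlock; apply/Pdiv.ClosedField.coprimepP => z /eqP fz0.
by rewrite deriv_map; exact: zeval_neq0_transfer der_x fz0.
Qed.

(** * The norm as a determinant *)

(* For [f] monic of degree [n], the matrix of multiplication by [p] on
   [Z[X]/(f)] in the basis of monomials. *)
Definition mulmat (f p : {poly int}) n : 'M[int]_n :=
  \matrix_(i < n, j < n) (Pdiv.Ring.rmodp ('X^i * p) f)`_j.

(** The vector of powers of a root [z] of [f] is an eigenvector of the matrix, with eigenvalue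
    [p(z)]. *)
Lemma mulmatE (R : comNzRingType) (z : R) (f p : {poly int}) n (i : 'I_n) :
  f \is monic -> size f = n.+1 -> zeval z f = 0 ->
  \sum_j (mulmat f p n i j)%:~R * z ^+ j = z ^+ i * zeval z p.
Proof.
move=> mon_f sf fz0; set r := Pdiv.Ring.rmodp ('X^i * p) f.
have sr : (size r <= n)%N.
  by rewrite -ltnS -sf Pdiv.Ring.ltn_rmodpN0 ?monic_neq0.
have -> : z ^+ i * zeval z p = zeval z r.
  have := Pdiv.RingMonic.rdivp_eq mon_f ('X^i * p).
  move/(congr1 (fun q => zeval z q)).
  by rewrite zevalD !zevalM zevalXn fz0 mulr0 add0r.
rewrite (@horner_coef_wide _ n) ?(leq_trans (size_poly _ _)) //.
by apply: eq_bigr => j _; rewrite mxE coef_map.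
Qed.

(** The eigenvectors at all the roots form a Vandermonde matrix, invertible since the roots are
    distinct; it diagonalizes the multiplication matrix. *)
Lemma det_mulmat (f p : {poly int}) (zs : seq algC) :
  f \is monic -> uniq zs -> map_poly intr f = \prod_(z <- zs) ('X - z%:P) ->
  (\det (mulmat f p (size zs)))%:~R = \prod_(z <- zs) zeval z p.
Proof.
move=> mon_f uniq_zs Df; set n := size zs.
have sf : size f = n.+1.
  by rewrite -(size_map_inj_poly (@intr_inj algC)) // Df size_prod_XsubC.
pose t : 'rV[algC]_n := \row_k zs`_k.
have fz0 (k : 'I_n) : zeval (zs`_k) f = 0.
  by apply/eqP; rewrite -[_ == _]/(root _ _) Df root_prod_XsubC mem_nth.
pose D : 'rV[algC]_n := \row_k zeval zs`_k p.
have V0 : \det (Vandermonde n t) != 0.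
  rewrite det_Vandermonde; apply/prodf_neq0 => i _; apply/prodf_neq0 => j ij.
  by rewrite !mxE subr_eq0 nth_uniq // neq_ltn ij orbT.
have MV : map_mx intr (mulmat f p n) *m Vandermonde n t =
    Vandermonde n t *m diag_mx D.
  apply/matrixP => i k; rewrite mul_mx_diag !mxE.
  under eq_bigr do rewrite !mxE.
  rewrite -(mulmatE p i mon_f sf (fz0 k)).
  by apply: eq_bigr => j _; rewrite !mxE.
apply: (mulIf V0); rewrite -det_map_mx -det_mulmx MV det_mulmx mulrC.
congr (_ * _); rewrite det_diag [RHS](big_nth 0) big_mkord.
by apply: eq_bigr => k _; rewrite mxE.
Qed.

(** With [b] the vector of powers of [x], [M b = p(x) b] gives [p(x) adj(M) b = det(M) b]. As [b]
    starts with 1, the first row reads [p(x) w(x) = det(M)], where [w] has the first row of the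
    adjugate as coefficients. *)
Lemma zeval_dvd_norm (K : fieldExtType rat) (x : K) (f p : {poly int})
    (zs : seq algC) :
  f \is monic -> uniq zs -> map_poly intr f = \prod_(z <- zs) ('X - z%:P) ->
  (0 < size zs)%N -> zeval x f = 0 ->
  exists w : {poly int}, exists2 N : int,
    N%:~R = \prod_(z <- zs) zeval z p & zeval x p * zeval x w = N%:~R.
Proof.
move=> mon_f uniq_zs Df n0 fx0; set n := size zs in n0.
have sf : size f = n.+1.
  by rewrite -(size_map_inj_poly (@intr_inj algC)) // Df size_prod_XsubC.
pose M := mulmat f p n; pose i0 := Ordinal n0.
exists (\sum_j (\adj M i0 j) *: 'X^j), (\det M); first exact: det_mulmat.
pose b : 'cV[K]_n := \col_j x ^+ j.
have Mb : map_mx intr M *m b = zeval x p *: b.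
  apply/matrixP => i k; rewrite !mxE mulrC -(mulmatE p i mon_f sf fx0).
  by apply: eq_bigr => j _; rewrite !mxE.
have : (zeval x p *: (\adj (map_mx intr M) *m b)) i0 0 = (\det M)%:~R.
  rewrite scalemxAr -Mb mulmxA mul_adj_mx mul_scalar_mx !mxE det_map_mx.
  by rewrite expr0 mulr1.
rewrite !mxE => <-; congr (_ * _); rewrite zeval_sum.
apply: eq_bigr => j _; rewrite zevalZ zevalXn.
by rewrite -map_mx_adj !mxE.
Qed.

(** * Small values of integer polynomials *)

Lemma pigeonhole (X Y : finType) (g : X -> Y) :
  (#|Y| < #|X|)%N -> exists a b, a != b /\ g a = g b.
Proof.
move=> ltYX; case: (boolP (injectiveb g)) => [/injectiveP/leq_card|].
  by rewrite leqNgt ltYX.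
by case/injectivePn=> a [b ? ?]; exists a, b.
Qed.

Lemma absz_dist_ord A (a b : 'I_A) : (absz (a%:Z - b%:Z) <= A)%N.
Proof. by move: (ltn_ord a) (ltn_ord b); lia. Qed.

Lemma coef_sumX n (c : 'I_n -> int) (i : 'I_n) :
  (\sum_j c j *: 'X^j)`_i = c i.
Proof.
rewrite coef_sum (bigD1 i) //= coefZ coefXn eqxx mulr1 big1 ?addr0 // => j ji.
by rewrite coefZ coefXn (inj_eq val_inj) eq_sym (negPf ji) mulr0.
Qed.

Lemma size_sumX n (c : 'I_n -> int) :
  (size (\sum_j c j *: 'X^j : {poly int})%R <= n)%N.
Proof.
apply: (leq_trans (size_sum _ _ _)); apply/bigmax_leqP => j _.
by rewrite (leq_trans (size_scale_leq _ _)) // size_polyXn.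
Qed.

(** Among the [A ^ n] coefficient vectors two collide under [g], and [p] is their difference. The
    vectors stay in the conclusion because [g] will record the cells of their values. *)
Lemma box_pigeonhole n A (Y : finType) (g : {ffun 'I_n -> 'I_A} -> Y) :
  (#|Y| < A ^ n)%N ->
  exists (p : {poly int}) a b, [/\ g a = g b, p != 0, (size p <= n)%N,
    forall i : 'I_n, (absz (p`_i)%R <= A)%N
  & forall z : algC, zeval z p =
      \sum_(i < n) (a i)%:R * z ^+ i - \sum_(i < n) (b i)%:R * z ^+ i].
Proof.
move=> ltYA; have [|a [b [neq_ab gab]]] := @pigeonhole _ _ g _.
  by rewrite card_ffun !card_ord.
pose c i := (a i)%:Z - (b i)%:Z.
exists (\sum_i c i *: 'X^i), a, b; split=> // [||i|z].
- apply: contraNneq neq_ab => c0; apply/eqP/ffunP => i; apply/val_inj.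
  have := coef_sumX c i; rewrite c0 coef0 /c => /esym/eqP.
  by rewrite subr_eq0 => /eqP[].
- exact: size_sumX.
- by rewrite coef_sumX absz_dist_ord.
rewrite zeval_sum -sumrB; apply: eq_bigr => i _.
by rewrite zevalZ zevalXn rmorphB mulrBl.
Qed.

Lemma norm_box (z : algC) n (c : 'I_n -> int) (A C : nat) :
  \sum_(i < n) `|z| ^+ i <= C%:R -> (forall i, absz (c i) <= A)%N ->
  `|\sum_(i < n) (c i)%:~R * z ^+ i| <= (C * A)%:R.
Proof.
move=> leC leA; apply: le_trans (ler_norm_sum _ _ _) _.
rewrite natrM mulrC; apply: le_trans (_ : A%:R * \sum_(i < n) `|z| ^+ i <= _).
  rewrite mulr_sumr; apply: ler_sum => i _; rewrite normrM normrX.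
  rewrite ler_wpM2r ?exprn_ge0 // -intr_norm -[`|c i|]/((absz (c i))%:Z).
  by rewrite ler_nat.
by rewrite ler_wpM2l ?ler0n.
Qed.

Lemma norm_zeval (z : algC) n (p : {poly int}) (A C : nat) :
  \sum_(i < n) `|z| ^+ i <= C%:R -> (size p <= n)%N ->
  (forall i : 'I_n, absz (p`_i)%R <= A)%N -> `|zeval z p| <= (C * A)%:R.
Proof.
move=> leC sp leA.
rewrite (@horner_coef_wide _ n) ?(leq_trans (size_poly _ _)) //.
under eq_bigr do rewrite coef_map.
exact: norm_box.
Qed.

(** The number of the interval of length [1 / T] that contains a real [r] with [|r| <= B]: the floor
    of [T * r] lies between [- T * B] and [T * B], and is shifted to start at 0. For other [r] the
    value carries no information. *)
Definition cell (T B : nat) (r : algC) : 'I_(T * B).*2.+1 :=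
  inord (absz (Num.floor (T%:R * r) + (T * B)%:Z)).

Lemma cell_eq T B (r s : algC) :
  r \is Num.real -> s \is Num.real -> `|r| <= B%:R -> `|s| <= B%:R ->
  cell T B r = cell T B s -> T%:R * `|r - s| <= 1.
Proof.
move=> Rr Rs rB sB.
have RT (t : algC) : t \is Num.real -> T%:R * t \is Num.real.
  by move=> Rt; rewrite rpredM ?realn.
have bound (t : algC) : t \is Num.real -> `|t| <= B%:R ->
    (- (T * B)%:Z <= Num.floor (T%:R * t) <= (T * B)%:Z).
  move=> Rt tB; have Rt' := RT t Rt.
  have : `|T%:R * t| <= (T * B)%:R.
    by rewrite normrM normr_nat natrM ler_wpM2l ?ler0n.
  rewrite real_ler_norml // => /andP[lo hi]; apply/andP; split.
    by rewrite real_floor_ge_int // rmorphN.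
  rewrite -ltzD1 real_floor_lt_int // rmorphD /=.
  by apply: le_lt_trans hi _; rewrite ltrDl ltr01.
rewrite /cell => /(congr1 val); have := bound r Rr rB; have := bound s Rs sB.
move: (Num.floor _) (real_floor_itv (RT s Rs)) => u us.
move: (Num.floor _) (real_floor_itv (RT r Rr)) => v vr.
move=> hu hv; rewrite /= !inordK; [|lia|lia] => uv.
have {uv} Duv : u = v by lia.
rewrite {}Duv in us; rewrite -[T%:R]normr_nat -normrM mulrBr.
case/andP: us => us1 us2; case/andP: vr => vr1 vr2.
rewrite real_ler_norml ?rpredB ?RT //; apply/andP; split.
  rewrite lerNl opprB lerBlDl; apply: ltW; apply: lt_le_trans us2 _.
  by rewrite rmorphD lerD2r.
rewrite lerBlDl; apply: ltW; apply: lt_le_trans vr2 _.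
by rewrite rmorphD lerD2r.
Qed.

(** All [A ^ n] values at [z] lie between [- C * A] and [C * A], where there are fewer cells of side
    [1 / T]; two values share a cell. *)
Lemma small_zeval_real (z : algC) n (A T C : nat) :
  z \is Num.real -> \sum_(i < n) `|z| ^+ i <= C%:R ->
  ((T * (C * A)).*2.+1 < A ^ n)%N ->
  exists p : {poly int}, [/\ p != 0, (size p <= n)%N,
    forall i : 'I_n, (absz (p`_i)%R <= A)%N & T%:R * `|zeval z p| <= 1].
Proof.
move=> Rz leC ltA.
pose V (a : {ffun 'I_n -> 'I_A}) : algC := \sum_(i < n) (a i)%:R * z ^+ i.
have VB a : `|V a| <= (C * A)%:R.
  apply: (@norm_box _ _ (fun i => (a i)%:Z)) leC _ => i.
  exact: ltnW (ltn_ord _).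
have RV a : V a \is Num.real.
  by apply: rpred_sum => i _; rewrite rpredM ?realn ?rpredX.
have [|p [a [b [ab p0 sp pA Dp]]]] :=
    @box_pigeonhole _ _ _ (fun a => cell T (C * A) (V a)) _.
  by rewrite card_ord.
exists p; split=> //; rewrite Dp; exact: cell_eq ab.
Qed.

(** Real and imaginary parts are put into cells separately, whence the square in the count and the
    bound [2 = 1 + 1]. *)
Lemma small_zeval_complex (z : algC) n (A T C : nat) :
  \sum_(i < n) `|z| ^+ i <= C%:R ->
  ((T * (C * A)).*2.+1 ^ 2 < A ^ n)%N ->
  exists p : {poly int}, [/\ p != 0, (size p <= n)%N,
    forall i : 'I_n, (absz (p`_i)%R <= A)%N & T%:R * `|zeval z p| <= 2].
Proof.
move=> leC ltA.
pose V (a : {ffun 'I_n -> 'I_A}) : algC := \sum_(i < n) (a i)%:R * z ^+ i.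
have VB a : `|V a| <= (C * A)%:R.
  apply: (@norm_box _ _ (fun i => (a i)%:Z)) leC _ => i.
  exact: ltnW (ltn_ord _).
have ReB a : `|'Re (V a)| <= (C * A)%:R.
  by apply: le_trans (VB a); rewrite leif_normC_Re_Creal.
have ImB a : `|'Im (V a)| <= (C * A)%:R.
  apply: le_trans (VB a); rewrite -(@ler_pXn2r _ 2) ?nnegrE //.
  rewrite (normC2_Re_Im (V a)) real_normK ?Creal_Im // lerDr.
  by rewrite real_exprn_even_ge0 ?Creal_Re.
have [|p [a [b [ab p0 sp pA Dp]]]] := @box_pigeonhole _ _ _
    (fun a => (cell T (C * A) ('Re (V a)), cell T (C * A) ('Im (V a)))) _.
  by rewrite card_prod !card_ord.
exists p; split=> //; case: ab => abR abI.
rewrite Dp -/(V a) -/(V b) [V a - V b]Crect.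
have R1 : T%:R * `|'Re (V a - V b)| <= 1.
  by rewrite raddfB; apply: cell_eq abR; rewrite ?Creal_Re.
have I1 : T%:R * `|'Im (V a - V b)| <= 1.
  by rewrite raddfB; apply: cell_eq abI; rewrite ?Creal_Im.
have -> : 2 = 1 + 1 :> algC by [].
apply: le_trans (lerD R1 I1); rewrite -mulrDr ler_wpM2l ?ler0n //.
by apply: le_trans (ler_normD _ _) _; rewrite lerD2l normrM normCi mul1r.
Qed.

(** * Approximants of bounded norm *)

Lemma norm_prod_leq (s : seq algC) (F : algC -> algC) (E : algC) :
  (forall z, z \in s -> `|F z| <= E) -> `|\prod_(z <- s) F z| <= E ^+ size s.
Proof.
elim: s => [|z s IHs] leE; first by rewrite big_nil normr1.
rewrite big_cons normrM exprS ler_pM //; first by rewrite leE ?mem_head.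
by apply: IHs => t ts; rewrite leE // inE ts orbT.
Qed.

Lemma zeval_conj (z : algC) (p : {poly int}) : zeval z^* p = (zeval z p)^*.
Proof.
rewrite -horner_map -map_poly_comp; congr (_.[_]); apply: eq_map_poly => i.
by rewrite /= rmorph_int.
Qed.

Lemma power_sum_bound (zs : seq algC) n :
  exists C : nat, forall z, z \in zs -> \sum_(i < n) `|z| ^+ i <= C%:R.
Proof.
elim: zs => [|z s [C leC]]; first by exists 0%N.
have S0 : 0 <= \sum_(i < n) `|z| ^+ i.
  by apply: sumr_ge0 => i _; rewrite exprn_ge0.
exists (Num.bound (\sum_(i < n) `|z| ^+ i) + C)%N => t.
rewrite inE natrD => /orP[/eqP-> | ts].
  by apply: ler_wpDr; rewrite ?ler0n // ltW // archi_boundP.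
by apply: ler_wpDl; rewrite ?ler0n // leC.
Qed.

(** With [n] the number of roots, the value at [z0] is of order [m ^ (1 - n)] and the [n - 1] other
    values are of order [m], so the powers of [m] cancel in the norm. *)
Lemma approximants_real (zs : seq algC) (z0 : algC) :
  z0 \in zs -> z0 \is Num.real -> (1 < size zs)%N ->
  exists B : nat, forall m : nat, (0 < m)%N -> exists p : {poly int},
    [/\ p != 0, (size p <= size zs)%N, m%:R * `|zeval z0 p| <= 2
      & `|\prod_(z <- zs) zeval z p| <= B%:R].
Proof.
move=> z0s Rz0 n_gt1; have [C leC] := power_sum_bound zs (size zs).
have [k Dn] : exists k, size zs = k.+2 by exists (size zs).-2; lia.
(* The coefficients range below [D m] and the cells have side [m ^ (1 - n)]. *)
pose D := (C.*2 + 2)%N; exists ((C * D) ^ k.+1)%N => m m0.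
have ltA : ((m ^ k.+1 * (C * (D * m))).*2.+1 < (D * m) ^ size zs)%N.
  have M0 : (0 < m ^ k.+2)%N by rewrite expn_gt0 m0.
  have -> : (m ^ k.+1 * (C * (D * m)) = C * D * m ^ k.+2)%N.
    by rewrite [in RHS]expnSr; lia.
  rewrite Dn expnMn; move: (m ^ k.+2)%N M0 => M M0.
  have D2 : (D ^ 2 <= D ^ k.+2)%N by apply: leq_pexp2l; rewrite /D; lia.
  apply: leq_trans (leq_mul D2 (leqnn M)); rewrite /D; nia.
have [p [p0 sp pA pT]] := small_zeval_real Rz0 (leC _ z0s) ltA.
exists p; split=> //.
  apply: le_trans (_ : 1 <= _); last by rewrite ler1n.
  apply: le_trans pT; rewrite ler_wpM2r // ler_nat -{1}(expn1 m).
  exact: leq_pexp2l.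
rewrite (perm_big _ (perm_to_rem z0s)) big_cons normrM.
have /norm_prod_leq : forall z, z \in rem z0 zs ->
    `|zeval z p| <= (C * (D * m))%:R.
  by move=> z /mem_rem zs_z; apply: norm_zeval sp pA; exact: leC.
rewrite size_rem // Dn /= mulnA natrM exprMn -!natrX => le_rest.
apply: le_trans (ler_wpM2l (normr_ge0 _) le_rest) _.
by rewrite mulrCA -[leRHS]mulr1 ler_wpM2l ?ler0n // mulrC.
Qed.

(** The values at [z0] and at its conjugate have the same modulus, of order [m ^ (2 - n)]; the
    [n - 2] others are of order [m ^ 2], so the powers of [m] cancel again. For [n = 2] the value at
    [z0] would not become small. *)
Lemma approximants_complex (zs : seq algC) (z0 : algC) :
  z0 \in zs -> z0^* \in zs -> z0^* != z0 -> (2 < size zs)%N ->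
  exists B : nat, forall m : nat, (0 < m)%N -> exists p : {poly int},
    [/\ p != 0, (size p <= size zs)%N, m%:R * `|zeval z0 p| <= 2
      & `|\prod_(z <- zs) zeval z p| <= B%:R].
Proof.
move=> z0s z0s' z0' n_gt2; have [C leC] := power_sum_bound zs (size zs).
have [k Dn] : exists k, size zs = k.+3 by exists (size zs).-2.-1; lia.
(* The coefficients range below [D m ^ 2] and the cells have side
   [m ^ (2 - n)]. *)
pose D := ((C.*2.+1) ^ 2).+1; exists (4 * (C * D) ^ k.+1)%N => m m0.
have ltA : ((m ^ k.+1 * (C * (D * m ^ 2))).*2.+1 ^ 2 < (D * m ^ 2) ^ size zs)%N.
  have M0 : (0 < m ^ k.+3)%N by rewrite expn_gt0 m0.
  have -> : (m ^ k.+1 * (C * (D * m ^ 2)) = C * D * m ^ k.+3)%N.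
    by rewrite -(addn2 k.+1) expnD; lia.
  have -> : ((D * m ^ 2) ^ size zs = D ^ k.+3 * (m ^ k.+3) ^ 2)%N.
    by rewrite Dn expnMn -!expnM [(2 * _)%N]mulnC.
  move: (m ^ k.+3)%N M0 => M M0.
  have D3 : (D ^ 3 <= D ^ k.+3)%N by apply: leq_pexp2l.
  apply: leq_trans (leq_mul D3 (leqnn _)).
  have DM0 : (0 < D * M)%N by rewrite muln_gt0 M0.
  (* As [D * M >= 1], the [+ 1] is absorbed by replacing [2 C] with [2 C + 1]; then
     [(2 C + 1) ^ 2 < D] by the choice of [D]. *)
  apply: (@leq_ltn_trans ((D * M * C.*2.+1) ^ 2)%N).
    by rewrite leq_exp2r // -mulnA [(C * _)%N]mulnC; nia.
  rewrite (_ : (D ^ 3 * M ^ 2 = (D * M) ^ 2 * D)%N); last first.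
    by rewrite expnMn expnS; lia.
  by rewrite expnMn ltn_pmul2l // expn_gt0 DM0.
have [p [p0 sp pA pT]] := small_zeval_complex (leC _ z0s) ltA.
exists p; split=> //.
  apply: le_trans pT; rewrite ler_wpM2r // ler_nat -{1}(expn1 m).
  exact: leq_pexp2l.
have z0s2 : z0^* \in rem z0 zs.
  by move: z0s'; rewrite (perm_mem (perm_to_rem z0s)) inE (negPf z0').
rewrite (perm_big _ (perm_to_rem z0s)) big_cons.
rewrite (perm_big _ (perm_to_rem z0s2)) big_cons !normrM zeval_conj norm_conjC.
have /norm_prod_leq : forall z, z \in rem z0^* (rem z0 zs) ->
    `|zeval z p| <= (C * (D * m ^ 2))%:R.
  by move=> z /mem_rem/mem_rem zs_z; apply: norm_zeval sp pA; exact: leC.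
rewrite !size_rem // Dn /= mulnA natrM exprMn -!natrX => le_rest.
rewrite mulrA; apply: le_trans (ler_wpM2l _ le_rest) _.
  by rewrite mulr_ge0.
rewrite natrM mulrCA [leRHS]mulrC ler_wpM2l ?ler0n //.
have -> : 4%:R = 2 * 2 :> algC by rewrite -natrM.
apply: le_trans (ler_pM _ _ pT pT); rewrite ?mulr_ge0 ?ler0n //.
by rewrite mulrACA mulrC -natrM -expnM mulnC expnM.
Qed.

Lemma minPoly_degree_gt1 (K : fieldExtType rat) (x : K) (f : {poly int}) :
  {:K}%VS <> 1%VS -> <<1; x>>%VS = {:K}%VS -> map_poly intr f = minPoly 1 x ->
  (2 < size f)%N.
Proof.
move=> notQ genK Df; rewrite ltnNge; apply/negP => sf; apply: notQ.
rewrite -genK; suff x1 : x \in 1%AS by rewrite (Fadjoin_idP x1).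
rewrite -adjoin_deg_eq1.
have := size_minPoly 1%AS x; rewrite -Df size_map_intr => Ds.
apply/eqP; have : (0 < adjoin_degree 1%AS x)%N by [].
by move: sf; rewrite Ds; lia.
Qed.

(** Completing the square: [2 x + b] generates [K] and its square is the discriminant [d]. If
    [d >= 0], then [2 z + b] would be a real square root of [d], and [z] real. *)
Lemma imaginary_quadratic_size3 (K : fieldExtType rat) (x : K)
    (f : {poly int}) (z : algC) :
  <<1; x>>%VS = {:K}%VS -> f \is monic -> size f = 3 -> zeval x f = 0 ->
  zeval z f = 0 -> z \isn't Num.real -> imaginary_quadratic K.
Proof.
move=> genK mon_f sf fx0 fz0 nRz.
pose b := f`_1; pose d := b ^+ 2 - 4 * f`_0.
have sqE (R : comNzRingType) (t : R) :
    zeval t f = 0 -> (2 * t + b%:~R) ^+ 2 = d%:~R.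
  have -> : zeval t f = (f`_0)%:~R + b%:~R * t + t ^+ 2.
    rewrite (@horner_coef_wide _ 3) ?(leq_trans (size_poly _ _)) ?sf //.
    rewrite !big_ord_recr big_ord0 /= add0r !coef_map /= (_ : f`_2 = 1).
      by rewrite mul1r mulr1.
    by move: mon_f; rewrite monicE /lead_coef sf => /eqP.
  move=> ft0.
  have -> : (2 * t + b%:~R) ^+ 2 = b%:~R ^+ 2 - 4 * (f`_0)%:~R +
      4 * ((f`_0)%:~R + b%:~R * t + t ^+ 2) by ring.
  by rewrite ft0 mulr0 addr0 /d rmorphB rmorphXn rmorphM.
exists d, (2 * x + b%:~R); split; last 2 first.
- exact: sqE.
- have two0 : 2 != 0 :> K.
    by rewrite -(rmorph_nat (in_alg K)) fmorph_eq0.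
  apply/eqP; rewrite -genK eqEsubv; apply/andP; split; apply/FadjoinP.
    rewrite subv_adjoin; split=> //.
    by rewrite rpredD ?rpred_int // rpredM ?rpred_nat ?memv_adjoin.
  rewrite subv_adjoin; split=> //; set y := _ + _.
  have -> : x = (y - b%:~R) / 2 by rewrite /y addrK mulrC mulKf.
  by rewrite rpredM ?rpredV ?rpred_nat // rpredB ?rpred_int ?memv_adjoin.
rewrite ltNge; apply: contra nRz => d0.
have Rs : sqrtC (d%:~R : algC) \is Num.real.
  by rewrite ger0_real // sqrtC_ge0 ler0z.
have two0 : 2 != 0 :> algC by rewrite pnatr_eq0.
have : 2 * z + b%:~R \is Num.real.
  have := sqE _ _ fz0; rewrite -(sqrtCK d%:~R) => /eqP.
  by rewrite eqf_sqr => /orP[]/eqP->; rewrite ?rpredN.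
move=> R2; have -> : z = (2 * z + b%:~R - b%:~R) / 2.
  by rewrite addrK mulrC mulKf.
by rewrite rpredM ?rpredV ?realn // rpredB // rpred_int.
Qed.

Lemma approximants (K : fieldExtType rat) (x : K) (f : {poly int})
    (zs : seq algC) :
  {:K}%VS <> 1%VS -> ~ imaginary_quadratic K -> <<1; x>>%VS = {:K}%VS ->
  f \is monic -> map_poly intr f = minPoly 1 x ->
  map_poly intr f = \prod_(z <- zs) ('X - z%:P) ->
  exists2 z0, z0 \in zs &
  exists B : nat, forall m : nat, (0 < m)%N -> exists p : {poly int},
    [/\ p != 0, (size p <= size zs)%N, m%:R * `|zeval z0 p| <= 2
      & `|\prod_(z <- zs) zeval z p| <= B%:R].
Proof.
move=> notQ notIQ genK mon_f Df Dzs.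
have sf : size f = (size zs).+1.
  by rewrite -(size_map_inj_poly (@intr_inj algC)) // Dzs size_prod_XsubC.
have n_gt1 : (1 < size zs)%N.
  by rewrite -ltnS -sf (minPoly_degree_gt1 notQ genK Df).
have zsE z : (z \in zs) = (zeval z f == 0).
  by rewrite -[_ == _]/(root _ _) Dzs root_prod_XsubC.
have [/hasP[z0 z0s Rz0]|/hasPn nR] := boolP (has (mem Num.real) zs).
  by exists z0 => //; apply: approximants_real.
have z0s : zs`_0 \in zs by rewrite mem_nth // (leq_trans _ n_gt1).
exists zs`_0 => //; move: (zs`_0) z0s => z0 z0s.
apply: approximants_complex => //.
- by rewrite zsE zeval_conj conjC_eq0 -zsE.
- by rewrite -CrealE; apply: nR.
have fx0 : zeval x f = 0 by rewrite Df minPolyxx.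
rewrite ltn_neqAle n_gt1 andbT; apply/eqP => n2; apply: notIQ.
apply: imaginary_quadratic_size3 genK mon_f _ fx0 _ (nR _ z0s).
  by rewrite sf -n2.
by apply/eqP; rewrite -zsE.
Qed.

(** * Units congruent to 1 modulo 2 *)

Lemma polyZ_dvd (D : int) (p : {poly int}) :
  (forall k, (D %| p`_k)%Z) -> exists g : {poly int}, p = D *: g.
Proof.
move=> dvD; exists (map_poly (divz^~ D) p); apply/polyP => k.
by rewrite coefZ coef_map_id0 ?div0z // mulrC divzK.
Qed.

Lemma congruent_quotient (K : fieldExtType rat) (x : K)
    (a b g w : {poly int}) (N : int) (B : nat) :
  zeval x b * zeval x w = N%:~R -> N != 0 -> (absz N <= B)%N ->
  a = b + (2 * B`!)%:Z *: g ->
  exists d : {poly int}, zeval x a = zeval x b * zeval x (1 + 2 *: d).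
Proof.
move=> bw N0 NB ->.
have /dvdzP[c Dc] : (N %| B`!%:Z)%Z.
  by rewrite dvdzE /= dvdn_fact // absz_gt0 N0.
exists (c *: (w * g)); rewrite !zevalD !zevalZ zevalM -polyC1 zevalC.
rewrite mulrDr mulr1 PoszM Dc !rmorphM /= -bw; congr (_ + _).
by ring.
Qed.

Lemma nontrivial_unit (K : fieldExtType rat) :
  {:K}%VS <> 1%VS -> ~ imaginary_quadratic K ->
  exists u v d : K,
    [/\ alg_integer v, alg_integer d, u = 1 + 2 * d, u * v = 1
      & forall k, (0 < k)%N -> u ^+ k != 1].
Proof.
move=> notQ notIQ; have [x int_x genK] := alg_integer_primitive K.
have [f mon_f Df] := int_minPoly int_x.
have [zs uniq_zs Dzs] := minPoly_complex_roots mon_f Df genK.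
have [z0 z0s [B apx]] := approximants notQ notIQ genK mon_f Df Dzs.
set n := size zs in apx.
have fx0 : zeval x f = 0 by rewrite Df minPolyxx.
have fz0 z : z \in zs -> zeval z f = 0.
  by move=> zs_z; apply/eqP; rewrite -[_ == _]/(root _ _) Dzs root_prod_XsubC.
have sf : size f = n.+1.
  by rewrite -(size_map_inj_poly (@intr_inj algC)) // Dzs size_prod_XsubC.
have n_gt0 : (0 < n)%N by rewrite lt0n size_eq0; apply: contraTneq z0s => ->.
pose good (p : {poly int}) :=
  [/\ p != 0, (size p <= n)%N & `|\prod_(z <- zs) zeval z p| <= B%:R].
have nz_x p : good p -> zeval x p != 0.
  by case=> p0 sp _; apply: zeval_small_neq0 Df p0 _; rewrite sf.
have nz_z p z : good p -> z \in zs -> zeval z p != 0.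
  by move=> /nz_x px /fz0; apply: zeval_neq0_transfer px.
have [F goodF] : exists F : {poly int} -> {poly int},
    forall p, good (F p) /\ (good p -> `|zeval z0 (F p)| < `|zeval z0 p|).
  suff H p : exists q, good q /\ (good p -> `|zeval z0 q| < `|zeval z0 p|).
    by have [F ?] := choice H; exists F.
  have [gp|ngp] := pselect (good p); last first.
    by have [q [? ? _ ?]] := apx 1%N isT; exists q; split.
  have pz0 : 0 < `|zeval z0 p| by rewrite normr_gt0 nz_z.
  have ltm : 2 / `|zeval z0 p| < (Num.bound (2 / `|zeval z0 p|))%:R.
    by rewrite archi_boundP // divr_ge0.
  set m := Num.bound _ in ltm.
  have m0 : (0 < m)%N.
    by rewrite -(ltr0n algC); apply: le_lt_trans ltm; rewrite divr_ge0.
  have [q [? ? qz0 ?]] := apx m m0; exists q; split=> // _.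
  rewrite -(ltr_pM2l (_ : 0 < m%:R)) ?ltr0n //.
  by apply: le_lt_trans qz0 _; rewrite -ltr_pdivrMr.
pose P i := iter i.+1 F 0.
have goodP i : good (P i) by case: (goodF (iter i F 0)).
have decrP i j : (i < j)%N -> `|zeval z0 (P j)| < `|zeval z0 (P i)|.
  apply: (homo_ltn (r := fun a b => `|zeval z0 (P b)| < `|zeval z0 (P a)|)).
    by move=> b a c ab bc; apply: lt_trans bc ab.
  by move=> k; case: (goodF (P k)) => _ /(_ (goodP k)).
pose D := (2 * B`!)%N; have D0 : (0 < D)%N by rewrite muln_gt0 fact_gt0.
have D_neq0 : D%:Z != 0 by rewrite -lt0n.
have lt_mod (c : int) : (absz (c %% D%:Z)%Z < D)%N.
  by rewrite -ltz_nat gez0_abs ?modz_ge0 ?ltz_pmod //; lia.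
pose key i : {ffun 'I_n -> 'I_D} :=
  [ffun k : 'I_n => Ordinal (lt_mod (P i)`_k)].
have [i [j [lt_ij key_ij]]] : exists i j, (i < j)%N /\ key i = key j.
  pose S := #|{: {ffun 'I_n -> 'I_D}}|.
  have [|a [b [neq_ab Dab]]] := @pigeonhole 'I_S.+1 _ (fun i => key i) _.
    by rewrite card_ord.
  have [ab|ba|/val_inj eq_ab] := ltngtP a b.
  - by exists a, b.
  - by exists b, a.
  by rewrite eq_ab eqxx in neq_ab.
have congP a b : key a = key b ->
    exists d : {poly int},
      zeval x (P a) = zeval x (P b) * zeval x (1 + 2 *: d).
  move=> Dab; have [w [N DN bw]] :=
    zeval_dvd_norm (P b) mon_f uniq_zs Dzs n_gt0 fx0.
  have [g Dg] : exists g, P a - P b = D%:Z *: g.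
    apply: polyZ_dvd => k; rewrite coefB -eqz_mod_dvd.
    have [lt_kn|le_nk] := ltnP k n; last first.
      have [[_ sa _] [_ sb _]] := (goodP a, goodP b).
      by rewrite !nth_default // (leq_trans _ le_nk).
    move/ffunP/(_ (Ordinal lt_kn)): Dab; rewrite !ffunE => /(congr1 val) /=.
    by move/(congr1 Posz); rewrite !gez0_abs ?modz_ge0 // => ->.
  apply: (@congruent_quotient _ _ _ _ g _ _ B bw).
  - rewrite -(intr_eq0 algC) DN prodf_seq_neq0; apply/allP => z zs_z.
    by apply: nz_z.
  - have [_ _] := goodP b; rewrite -DN -intr_norm -abszE.
    by rewrite ler_nat.
  by rewrite -[(2 * _)%:Z]/(D%:Z) -Dg addrC subrK.
have [[d Dd] [d' Dd']] := (congP j i (esym key_ij), congP i j key_ij).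
exists (zeval x (1 + 2 *: d)), (zeval x (1 + 2 *: d')), (zeval x d); split.
- exact: alg_integer_zeval.
- exact: alg_integer_zeval.
- by rewrite zevalD zevalZ -polyC1 zevalC.
- apply: (mulfI (nz_x _ (goodP i))); rewrite mulrA -Dd -Dd' mulr1.
  by [].
move=> k k0; apply/negP => /eqP uk1; set U := 1 + _ in Dd uk1.
have Uk1 : zeval z0 (U ^+ k - 1) = 0.
  apply: zeval_eq0_transfer mon_f Df _ (fz0 _ z0s).
  by rewrite zevalB zevalX uk1 -polyC1 zevalC subrr.
have normU : `|zeval z0 U| = 1.
  apply/eqP; rewrite -(@pexpr_eq1 _ _ k) // -normrX -zevalX.
  move/eqP: Uk1; rewrite zevalB subr_eq0 => /eqP->.
  by rewrite -polyC1 zevalC normr1.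
have : zeval z0 (P j - P i * U) = 0.
  apply: zeval_eq0_transfer mon_f Df _ (fz0 _ z0s).
  by rewrite zevalB zevalM Dd subrr.
rewrite zevalB zevalM => /eqP; rewrite subr_eq0 => /eqP DPj.
by have := decrP _ _ lt_ij; rewrite DPj normrM normU mulr1 ltxx.
Qed.

Lemma odd_poly_length (g : {poly int}) :
  odd (poly_length g) = odd (absz (zeval 1 g)).
Proof.
have abszD (a b : int) : odd (absz (a + b)) = odd (absz a) (+) odd (absz b).
  lia.
rewrite (@horner_coef_wide _ (size g)) ?size_poly // /poly_length.
elim/big_ind2: _ => // [a b c d|i _]; first by rewrite oddD abszD => -> ->.
by rewrite coef_map /= intz expr1n mulr1.
Qed.

Lemma congr1_mod2_even (K : fieldExtType rat) (u d : K) (g : {poly int}) :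
  alg_integer d -> u = 1 + 2 * d -> map_poly intr g = minPoly 1 u ->
  ~~ odd (poly_length g).
Proof.
move=> int_d Du Dg; rewrite odd_poly_length; set c := zeval 1 g.
have [q Dq] : exists q, g - c%:P = q * ('X - 1%:P).
  apply/factor_theorem; rewrite rootE hornerD hornerN hornerC /c.
  by rewrite map_poly_id ?subrr // => a _; rewrite intz.
have int_u : alg_integer u.
  rewrite Du; apply: integral_add; first exact: integral1.
  by apply: integral_mul => //; exact: integral_nat.
pose t := - (zeval u q * d).
have int_t : alg_integer t.
  by apply/integral_opp/integral_mul => //; exact: alg_integer_zeval.
have Dt : 2 * t = c%:~R.
  have := congr1 (fun p => zeval u p) Dq.
  rewrite !(zevalB, zevalM, zevalC) -['X]/('X^1) zevalXn Dg minPolyxx.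
  rewrite expr1 (_ : u - 1%:~R = 2 * d); last by rewrite Du addrC addKr.
  rewrite sub0r => /eqP; rewrite eqr_oppLR => /eqP->.
  by rewrite /t mulrN mulrCA.
have [f _ Df] := int_minPoly int_t.
have two0 : 2 != 0 :> K.
  by rewrite -(rmorph_nat (in_alg K)) fmorph_eq0.
have t1 : t \in 1%AS.
  by rewrite -[t](mulKf two0) Dt rpredM ?rpredV ?rpred_nat ?rpred_int.
have {Df} : (f`_0)%:~R = - t.
  have -> : (f`_0)%:~R = (map_poly intr f)`_0 :> K by rewrite coef_map.
  by rewrite Df (minPoly_XsubC t1) coefB coefX coefC sub0r.
move/eqP; rewrite -eqr_oppLR => /eqP Df.
have : c = 2 * - f`_0.
  apply: (@intr_fieldExt_inj K).
  by rewrite -Dt -Df rmorphM rmorphN.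
by move=> ->; lia.
Qed.

(** * Vanishing sums of units *)

Lemma poly_length_ge4 (K : fieldExtType rat) (u : K) (g : {poly int}) :
  u != 0 -> (forall k, (0 < k)%N -> u ^+ k != 1) ->
  g \is monic -> map_poly intr g = minPoly 1 u -> ~~ odd (poly_length g) ->
  (4 <= poly_length g)%N.
Proof.
move=> u0 inf_u mon_g Dg evL; rewrite leqNgt; apply/negP => L4.
have gu0 : zeval u g = 0 by rewrite Dg minPolyxx.
have [k sg] : exists k, size g = k.+2.
  have := size_minPoly 1%AS u; rewrite -Dg size_map_intr => ->.
  have : (0 < adjoin_degree 1%AS u)%N by [].
  by case: adjoin_degree => // k _; exists k.
have gk : g`_k.+1 = 1 by move: mon_g; rewrite monicE /lead_coef sg => /eqP.
have g0 : g`_0 != 0.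
  rewrite -horner_coef0 -rootE; apply/negP => /factor_theorem[q Dq].
  have q0 : q != 0.
    by apply/eqP => q0; move: (monic_neq0 mon_g); rewrite Dq q0 mul0r eqxx.
  have qu0 : zeval u q = 0.
    move: gu0; rewrite Dq subr0 zevalM -['X]/('X^1) zevalXn => /eqP.
    by rewrite mulf_eq0 (negPf u0) orbF => /eqP.
  have := size_minPoly_leq qu0 q0.
  by rewrite -Dg size_map_intr Dq subr0 size_mulX // ltnn.
move: L4 evL; rewrite /poly_length sg big_ord_recl big_ord_recr /= gk absz1.
move=> L4 evL.
have mid0 : (\sum_(i < k) absz (g`_(bump 0 i))%R = 0)%N.
  move: g0 L4 evL; rewrite -absz_gt0; move: (\sum_(i < k) _)%N => S.
  move: (absz _) => a; lia.
have {g0} g0 : g`_0 ^+ 2 = 1.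
  move: g0 L4 evL; rewrite mid0; move: (g`_0) => a a0 L4 evL.
  by have [->|->] : a = 1 \/ a = -1 by lia.
have uk : u ^+ k.+1 = - (g`_0)%:~R.
  move/eqP: gu0; rewrite (@horner_coef_wide _ k.+2); last first.
    by rewrite (leq_trans (size_poly _ _)) ?sg.
  rewrite big_ord_recl big_ord_recr /= big1 ?add0r => [|i _].
    rewrite !coef_map /= expr0 mulr1 /bump add1n gk mul1r addrC addr_eq0.
    by move/eqP.
  have /eqP := mid0; rewrite sum_nat_eq0 => /forallP/(_ i) /=.
  rewrite absz_eq0 coef_map /= => /eqP.
  by rewrite /bump => ->; rewrite mul0r.
have /eqP[] := inf_u (k.+1 * 2)%N isT.
by rewrite exprM uk sqrrN -rmorphXn g0.
Qed.

Lemma ev_admissible_unit (K : fieldExtType rat) (u : K) (g : {poly int}) :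
  int_unit u -> (forall k, (0 < k)%N -> u ^+ k != 1) ->
  g \is monic -> map_poly intr g = minPoly 1 u -> ~~ odd (poly_length g) ->
  ev_admissible K (poly_length g).
Proof.
case=> int_u [v int_v uv1] inf_u mon_g Dg evL.
have u0 : u != 0.
  by apply: contra_eq_neq uv1 => ->; rewrite mul0r eq_sym oner_eq0.
split=> //; first exact: poly_length_ge4 Dg evL.
pose n := size g; pose T := {i : 'I_n & 'I_(absz g`_i)}.
have -> : poly_length g = #|{: T}|.
  rewrite card_tagged sumnE big_map big_enum /=.
  by apply: eq_bigr => i _; rewrite card_ord.
pose tg (i : 'I_n) (j : 'I_(absz g`_i)) : T := Tagged _ j.
pose e (t : T) : K := (sgz g`_(tag t))%:~R * u ^+ tag t.
have sum_e (J : {set T}) : \sum_(t in J) e t =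
    zeval u (\sum_(i < n) (sgz g`_i *+ #|[set j | tg i j \in J]|) *: 'X^i).
  rewrite zeval_sum.
  under [RHS]eq_bigr => i _.
    rewrite zevalZ zevalXn rmorphMn mulrnAl -sumr_const.
    under eq_bigl do rewrite inE.
    over.
  rewrite (sig_big_dep _ (fun i j => tg i j \in J)) /=.
  by apply: eq_bigl => -[i j].
exists (fun k => e (enum_val k)); split=> [k||[I [I0 IT sumI]]].
- move: (enum_val k) => [i j].
  have gi0 : g`_i != 0 by rewrite -absz_gt0 (leq_ltn_trans (leq0n j)).
  have sg2 : sgz g`_i * sgz g`_i = 1 by case: sgzP gi0 => // ->; rewrite eqxx.
  have int_e (a : K) : alg_integer a -> alg_integer ((sgz g`_i)%:~R * a ^+ i).
    move=> int_a; apply: integral_mul; first exact: integral_id.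
    by rewrite -zevalXn; apply: alg_integer_zeval.
  split; first exact: int_e.
  exists ((sgz g`_i)%:~R * v ^+ i); first exact: int_e.
  by rewrite /e /= mulrACA -rmorphM sg2 -exprMn uv1 expr1n mulr1.
- transitivity (\sum_(t in [set: T]) e t).
    rewrite [RHS](reindex _ (onW_bij _ (enum_val_bij _))) /=.
    by apply: eq_bigl => k; rewrite inE.
  rewrite sum_e -[RHS](minPolyxx 1%AS u) -Dg; congr (zeval u _).
  apply/polyP => i; have [lt_in|le_ni] := ltnP i n; last first.
    by rewrite !nth_default // (leq_trans (size_sumX _)).
  rewrite -[i]/(nat_of_ord (Ordinal lt_in)) coef_sumX.
  have -> : [set j | tg (Ordinal lt_in) j \in [set: T]] = setT.
    by apply/setP => j; rewrite !inE.
  by rewrite cardsT card_ord -mulr_natr natz -intEsg.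
pose J := [set t : T | enum_rank t \in I].
have sumJ : \sum_(t in J) e t = 0.
  rewrite -[RHS]sumI [LHS](reindex _ (onW_bij _ (enum_val_bij _))) /=.
  by apply: eq_bigl => k; rewrite inE enum_valK.
pose c (i : 'I_n) := #|[set j | tg i j \in J]|.
pose p : {poly int} := \sum_(i < n) (sgz g`_i *+ c i) *: 'X^i.
have pu0 : zeval u p = 0 by rewrite -sum_e.
have n0 : (0 < n)%N by rewrite lt0n size_poly_eq0 monic_neq0.
have ltn1 : (n.-1 < n)%N by rewrite prednK.
pose l := Ordinal ltn1; have gl : g`_l = 1 by exact/eqP.
have cg (i : 'I_n) : (sgz g`_i *+ c i = (c l)%:Z * g`_i)%R.
  have q0 : p - (c l)%:Z *: g = 0.
    apply/eqP/negP => /negP q0.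
    have qu0 : zeval u (p - (c l)%:Z *: g) = 0.
      by rewrite zevalB zevalZ pu0 Dg minPolyxx mulr0 subr0.
    have := size_minPoly_leq qu0 q0; rewrite -Dg size_map_intr -/n leqNgt.
    case/negP; rewrite -(prednK n0) ltnS; apply/leq_sizeP => k le_k.
    have [lt_kn|le_nk] := ltnP k n; last first.
      rewrite coefB coefZ !nth_default ?mulr0 ?subr0 //.
      by rewrite (leq_trans (size_sumX _)).
    have -> : k = l :> nat by rewrite /=; lia.
    by rewrite coefB coefZ coef_sumX gl mulr1 sgz1 natz subrr.
  have := congr1 (fun q : {poly int} => q`_i) q0.
  by rewrite coefB coefZ coef_sumX coef0 => /eqP; rewrite subr_eq0 => /eqP.
have cE (i : 'I_n) : c i = (c l * absz (g`_i)%R)%N.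
  have [gi0|gi0] := eqVneq g`_i 0.
    apply/eqP; rewrite gi0 muln0 cards_eq0; apply/eqP/setP => j.
    by move: (ltn_ord j); rewrite {2}gi0.
  move: (cg i) gi0; rewrite -mulr_natr natz; case: (sgzP g`_i) => //; nia.
have cl1 : (c l <= 1)%N.
  by rewrite (leq_trans (max_card _)) // card_ord gl.
have [cl|cl] : c l = 0%N \/ c l = 1%N by lia.
  case/set0Pn: I0 => k Ik; have := cE (tag (enum_val k)); rewrite cl mul0n.
  move/eqP; rewrite cards_eq0 => /eqP/setP/(_ (tagged (enum_val k))).
  by rewrite !inE /tg taggedK enum_valK Ik.
case/negP: (proper_neq IT); apply/eqP/setP => k; rewrite inE.
have /eqP := cE (tag (enum_val k)); rewrite cl mul1n -[X in _ == X]card_ord.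
rewrite -cardsT => /eqP cT.
have : [set j | tg (tag (enum_val k)) j \in J] = setT.
  apply/eqP; rewrite eqEcard subsetT; move: cT; rewrite /c => ->.
  by rewrite leqnn.
move/setP => /(_ (tagged (enum_val k))).
by rewrite !inE /tg taggedK enum_valK.
Qed.

Theorem theorem7 (K : fieldExtType rat)
    (K_not_Q : {:K}%VS <> 1%VS)
    (K_not_imaginary_quadratic : ~ imaginary_quadratic K) :
  (exists u : K, [/\ int_unit u, even_integer u, u <> 1 & u <> -1])
  /\ (exists k : nat, ev K = Some k).
Proof.
have [u [v [d [int_v int_d Du uv1 inf_u]]]] :=
  nontrivial_unit K_not_Q K_not_imaginary_quadratic.
have int_u : alg_integer u.
  rewrite Du; apply: integral_add; first exact: integral1.
  by apply: integral_mul => //; exact: integral_nat.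
have unit_u : int_unit u by split=> //; exists v.
have [g mon_g Dg] := int_minPoly int_u.
have even_g := congr1_mod2_even int_d Du Dg.
split.
  exists u; split=> //; first by split=> //; exists g.
    by move=> u1; have /eqP[] := inf_u 1%N isT.
  by move=> u1; have /eqP[] := inf_u 2%N isT; rewrite u1 sqrrN expr1n.
rewrite /ev; case: pselect => [exk|[]]; first by exists (ex_minn exk).
exists (poly_length g); apply/asboolP.
exact: ev_admissible_unit unit_u inf_u mon_g Dg even_g.
Qed.
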